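(* Let $m,u\ge 2$ and $n,v\ge 0$ be integers. For integers $N,M,j\ge 0$ let $\mathcal{A}(N,M,j)$ denote the set of all $N$-tuples $(a_1,\dots,a_N)$ of positive integers with $a_1+\dots+a_N=M$ and such that exactly $j$ of the entries $a_s$ are even. Then $$ \begin{aligned} &\zeta^t(m,\{1\}^n)\,\zeta^t(u,\{1\}^v)\\ ={}&\sum_{l=1}^{n}\ \sum_{k=0}^{\min\{v,n-l\}}\ \sum_{\substack{i+j=k\\ i,j\ge 0}}\ \sum_{(a_1,\dots,a_N)\in\mathcal{A}(N,\,n+v-l,\,j)} \binom{v+n-l-2k}{v-k}(t^2-t)^i(1-2t)^j\\ &\quad\times\Big[\zeta^t(m,\{1\}^l,u,a_1,\dots,a_N)+(1-2t)\zeta^t(m,\{1\}^{l-1},u+1,a_1,\dots,a_N)\\ &\qquad\ +(1-\delta_{v,0}\delta_{n,l})(t^2-t)\zeta^t(m,\{1\}^{l-1},u+1+a_1,a_2,\dots,a_N)\Big]\\ &+\sum_{l=1}^{v}\ \sum_{k=0}^{\min\{n,v-l\}}\ \sum_{\substack{i+j=k\\ i,j\ge 0}}\ \sum_{(a_1,\dots,a_N)\in\mathcal{A}(N,\,n+v-l,\,j)} \binom{v+n-l-2k}{n-k}(t^2-t)^i(1-2t)^j\\ &\quad\times\Big[\zeta^t(u,\{1\}^l,m,a_1,\dots,a_N)+(1-2t)\zeta^t(u,\{1\}^{l-1},m+1,a_1,\dots,a_N)\\ &\qquad\ +(1-\delta_{n,0}\delta_{v,l})(t^2-t)\zeta^t(u,\{1\}^{l-1},m+1+a_1,a_2,\dots,a_N)\Big]\\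 &+\sum_{k=0}^{\min\{n,v\}}\ \sum_{\substack{i+j=k\\ i,j\ge 0}}\ \sum_{(a_1,\dots,a_{N'})\in\mathcal{A}(N',\,n+v,\,j)} \binom{v+n-2k}{n-k}(t^2-t)^i(1-2t)^j\\ &\quad\times\Big[\zeta^t(m,u,a_1,\dots,a_{N'})+\zeta^t(u,m,a_1,\dots,a_{N'})+(1-2t)\zeta^t(m+u,a_1,\dots,a_{N'})\\ &\qquad\ +(1-\delta_{n,0}\delta_{v,0})(t^2-t)\zeta^t(m+u+a_1,a_2,\dots,a_{N'})\Big], \end{aligned} $$ where $N=v+n-l-i-k$ in the first two sums and $N'=v+n-i-k$ in the third.
   Context: For positive integers $k_1,\dots,k_n$ with $k_1\ge 2$ (an admissible index), the multiple zeta value is $\zeta(k_1,\dots,k_n)=\sum_{m_1>\cdots>m_n\ge 1}\frac{1}{m_1^{k_1}\cdots m_n^{k_n}}$, and the interpolated multiple zeta value is the polynomial $$\zeta^t(k_1,\dots,k_n)=\sum_{\mathbf p}t^{\,n-\mathrm{dep}(\mathbf p)}\zeta(\mathbf p)\in\mathbb{R}[t],$$ where $\mathbf p$ runs over the $2^{n-1}$ indices $(k_1\Box k_2\Box\cdots\Box k_n)$ obtained by replacing each $\Box$ by either a comma or a plus sign, and $\mathrm{dep}(\mathbf p)$ is the number of entries of $\mathbf p$. $\{1\}^l$ denotes $1$ repeated $l$ times (omitted if $l=0$); $\delta_{i,j}$ is Kronecker's delta. Empty sums are $0$; $\mathcal{A}(0,0,0)$ consists of the empty tuple and $\mathcal{A}(0,M,j)$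 is empty for $(M,j)\ne(0,0)$. A term involving $a_1$ when there is no $a_1$ (empty tuple) occurs only with coefficient $1-\delta\delta=0$ and is read as $0$. *)

(* Defs.v *)
From HB Require Import structures.
From mathcomp Require Import all_boot all_order all_algebra.
From mathcomp Require Import boolp classical_sets reals ereal esum.

Set Implicit Arguments.
Unset Strict Implicit.
Unset Printing Implicit Defensive.

Import Order.TTheory GRing.Theory Num.Theory.
Local Open Scope classical_set_scope.
Local Open Scope ring_scope.

(* An index (k_1, ..., k_n) is a [seq nat], head first. The sum is a sum of
   nonnegative terms over the set of all m_1 > ... > m_n >= 1, computed in
   [\bar R]; it is finite when the index is admissible (positive entries,
   k_1 >= 2), and [fine] then returns its value. *)
Definition zeta (R : realType) (k : seq nat) : R :=
  fine (\esum_(m in [set m : seq nat |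
                 [/\ size m = size k, sorted gtn m & all (leq 1) m]])
          (\prod_(i < size k) ((nth 0%N m i)%:R ^+ nth 0%N k i)^-1)%:E).

(* The index (k_1 [] k_2 [] ... [] k_n) with ks = (k_2, ..., k_n), where the
   s-th box is a plus sign if the s-th bit of [b] is [true], and a comma if it
   is [false]. *)
Fixpoint fill_boxes (k1 : nat) (ks : seq nat) (b : bitseq) : seq nat :=
  match ks, b with
  | k2 :: ks', true :: b' => fill_boxes (k1 + k2) ks' b'
  | k2 :: ks', false :: b' => k1 :: fill_boxes k2 ks' b'
  | _, _ => [:: k1]
  end.

(* The interpolation variable t is ['X]; the depth of an index is its size. *)
Definition zetat (R : realType) (k : seq nat) : {poly R} :=
  if k is k1 :: ks then
    \sum_(b : (size ks).-tuple bool)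
      let p := fill_boxes k1 ks b in
      'X^(size k - size p) * (zeta R p)%:P
  else 1.

(* Duplicate-free enumeration of the N-tuples of positive integers with sum M
   and exactly j even entries: see [mem_tuplesA] and [uniq_tuplesA]. Since the
   sum is M, it is enough to look for the entries in {0, ..., M}. *)
Definition tuplesA (N M j : nat) : seq (seq nat) :=
  [seq a <- [seq [seq val x | x <- tval c] | c : N.-tuple 'I_M.+1]
     | [&& all (leq 1) a, sumn a == M & count (predC odd) a == j]].

Lemma mem_tuplesA (N M j : nat) (a : seq nat) :
  (a \in tuplesA N M j) =
  [&& size a == N, all (leq 1) a, sumn a == M & count (predC odd) a == j].
Proof.
rewrite mem_filter andbC; case Ha: [&& all _ _, _ & _]; last first.
  by rewrite andbF; case: (size a == N).
rewrite !andbT; apply/mapP/idP => [[c _ ->]|/eqP sa].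
  by rewrite size_map size_tuple.
have aM x : x \in a -> (x <= M)%N.
  case/and3P: Ha => _ /eqP <- _; elim: a {sa} => //= y s IHs.
  rewrite inE => /orP[/eqP->|/IHs xs]; first exact: leq_addr.
  by apply: leq_trans xs _; exact: leq_addl.
have sc : size [seq (inord x : 'I_M.+1) | x <- a] == N by rewrite size_map sa.
exists (Tuple sc); rewrite ?mem_enum //=; rewrite -map_comp -[LHS]map_id.
by apply/eq_in_map => x /aM xM /=; rewrite inordK.
Qed.

Lemma uniq_tuplesA (N M j : nat) : uniq (tuplesA N M j).
Proof.
apply/filter_uniq/dinjectiveP => c d _ _ /(inj_map val_inj) cd.
exact: val_inj.
Qed.

(* Main.v *)
Require Import Defs.
From HB Require Import structures.
From mathcomp Require Import all_boot all_order all_algebra.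
From mathcomp Require Import boolp classical_sets reals ereal esum.
From mathcomp Require Import cardinality fsbigop topology normedtype sequences.
From mathcomp Require Import ring lra zify.

Set Implicit Arguments.
Unset Strict Implicit.
Unset Printing Implicit Defensive.

Import Order.TTheory GRing.Theory Num.Theory.
Import numFieldNormedType.Exports.
Local Open Scope ring_scope.

(* Truncate all sums at m_1 <= M. The truncations A_M of zeta^t satisfy
   A_M(k,w) - A_(M-1)(k,w) = M^-k ((1 - t) A_(M-1)(w) + t A_M(w)),
   and induction on M turns this into the product rule of the t-harmonic
   product,
     z_k w1 * z_l w2 = z_k (w1 * z_l w2) + z_l (z_k w1 * w2)
       + (1 - 2t) z_(k+l) (w1 * w2) + (t^2 - t) z_(k+l) o (w1 * w2),
   where z_c o z_a w = z_(c+a) w. Unfolding the rule, z_m z_1^n * z_u z_1^v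
   reduces to the products z_1^n' * z_1^v', in which a composition a of n'+v'
   with j even entries gets, with K = \sum_s floor(a_s / 2), the coefficient
   C(n'+v'-2K, n'-K) (t^2-t)^(K-j) (1-2t)^j: the recursion on n', v' removes a
   leading 1 (Pascal's rule) or a leading 2, or lowers the first entry by 2. Finally
   M tends to infinity; the truncations converge because those of zeta(2,{1}^n)
   are bounded. *)

(** * The t-harmonic product *)

(* A formal linear combination of words is represented by the linear functional
   that evaluates a function F on it. *)
Definition lin_functional (S : comNzRingType) (L : (seq nat -> S) -> S) :=
  forall c F G, L (fun w => c * F w + G w) = c * L F + L G.

(* F (z_c o w); the word z_c o [::] is read as 0. *)
Definition onhead (S : nmodType) (c : nat) (F : seq nat -> S) (w : seq nat) : S :=
  if w is a :: w' then F ((c + a)%N :: w') else 0.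

(** [A M] sums over M >= m_1 >= m_2 >= ... >= 1 with a factor t for each equality and [x m] in place
    of 1/m. If m_1 = M + 1, then m_2 <= M has weight 1 and m_2 = M + 1 has weight t, whence the last
    clause. *)
Definition interpolated_sums (S : comNzRingType) (t : S) (x : nat -> S)
    (A : nat -> seq nat -> S) :=
  [/\ forall M, A M [::] = 1, forall k w, A 0%N (k :: w) = 0
    & forall M k w, A M.+1 (k :: w) =
        A M (k :: w) + x M.+1 ^+ k * ((1 - t) * A M w + t * A M.+1 w)].

Lemma lin_functional0 (S : comNzRingType) (L : (seq nat -> S) -> S) :
  lin_functional L -> L (fun=> 0) = 0.
Proof.
move=> hL; rewrite -[RHS](addNr (L (fun=> 0))) -[X in _ = X + _]mulN1r -hL.
by congr L; apply/funext => w; rewrite mulr0 addr0.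
Qed.

Lemma lin_functionalD (S : comNzRingType) (L : (seq nat -> S) -> S) F G :
  lin_functional L -> L (fun w => F w + G w) = L F + L G.
Proof.
move=> hL; rewrite -[L F]mul1r -hL.
by congr L; apply/funext => w; rewrite mul1r.
Qed.

Lemma lin_functionalZ (S : comNzRingType) (L : (seq nat -> S) -> S) c F :
  lin_functional L -> L (fun w => c * F w) = c * L F.
Proof.
move=> hL; rewrite -[RHS]addr0 -[X in _ = _ + X](lin_functional0 hL) -hL.
by congr L; apply/funext => w; rewrite addr0.
Qed.

Lemma onhead_lin (S : comNzRingType) k (c : S) F G :
  onhead k (fun w => c * F w + G w) = (fun w => c * onhead k F w + onhead k G w).
Proof. by apply/funext => -[|a w] //=; rewrite mulr0 addr0. Qed.

Lemma lin_functional_step (S : comNzRingType) (L : (seq nat -> S) -> S) t x A :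
    interpolated_sums t x A -> lin_functional L ->
  forall M k, L (fun w => A M.+1 (k :: w)) =
    L (fun w => A M (k :: w))
    + x M.+1 ^+ k * ((1 - t) * L (A M) + t * L (A M.+1)).
Proof.
case=> _ _ AS hL M k; under eq_fun do rewrite AS.
by rewrite lin_functionalD // lin_functionalZ // lin_functionalD // !lin_functionalZ.
Qed.

(** By [AS] at the exponents k + a and a, adding k to the head multiplies the increment by x^k. On
    the empty word both increments vanish. *)
Lemma lin_functional_onhead_step (S : comNzRingType) (L : (seq nat -> S) -> S) t x A :
    interpolated_sums t x A -> lin_functional L ->
  forall M k, L (onhead k (A M.+1)) =
    L (onhead k (A M)) + x M.+1 ^+ k * (L (A M.+1) - L (A M)).
Proof.
case=> A1 _ AS hL M k.
have -> : onhead k (A M.+1) = fun w => x M.+1 ^+ k * (-1 * A M w + A M.+1 w)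
                                       + onhead k (A M) w.
  apply/funext => -[|a w] /=; first by rewrite !A1; ring.
  by rewrite !AS exprD; ring.
by rewrite hL hL; ring.
Qed.

(** Induction on M: both sides vanish at 0 and have equal increments. With p, q and p', q' the
    values at w1, w2 before and after the step, 1 - 2t and t^2 - t are the coefficients that balance
    pq and p'q' in the product of the two increments. *)
Lemma stuffle (S : comNzRingType) (t : S) x A (L1 L2 L3 : (seq nat -> S) -> S)
    k l w1 w2 :
    interpolated_sums t x A ->
    lin_functional L1 -> lin_functional L2 -> lin_functional L3 ->
    (forall M, A M w1 * A M (l :: w2) = L1 (A M)) ->
    (forall M, A M (k :: w1) * A M w2 = L2 (A M)) ->
    (forall M, A M w1 * A M w2 = L3 (A M)) ->
  forall M, A M (k :: w1) * A M (l :: w2) =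
    L1 (fun w => A M (k :: w)) + L2 (fun w => A M (l :: w))
    + (1 - 2%:R * t) * L3 (fun w => A M ((k + l)%N :: w))
    + (t ^+ 2 - t) * L3 (onhead (k + l) (A M)).
Proof.
move=> hA l1 l2 l3 h1 h2 h3; have [_ A0 AS] := hA; elim=> [|M IHM].
  have on0 : onhead (k + l) (A 0%N) = fun=> 0.
    by apply/funext => -[|a w] //=.
  have cons0 h : (fun w => A 0%N (h :: w)) = fun=> 0 by apply/funext.
  by rewrite on0 !cons0 !lin_functional0 // !A0; ring.
rewrite !(lin_functional_step hA) // (lin_functional_onhead_step hA) //.
rewrite -!h1 -!h2 -!h3 !AS exprD mulrDl !mulrDr IHM.
ring.
Qed.

(* The combination z_1^n * z_1^v. *)
Fixpoint ones_prod (S : comNzRingType) (t : S) n : nat -> (seq nat -> S) -> S :=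
  fix ones_prod_n v F :=
  match n, v with
  | 0, 0 => F [::]
  | n'.+1, 0 => ones_prod t n' 0 (fun w => F (1%N :: w))
  | 0, v'.+1 => ones_prod_n v' (fun w => F (1%N :: w))
  | n'.+1, v'.+1 =>
      ones_prod t n' v (fun w => F (1%N :: w))
      + ones_prod_n v' (fun w => F (1%N :: w))
      + (1 - 2%:R * t) * ones_prod t n' v' (fun w => F (2%N :: w))
      + (t ^+ 2 - t) * ones_prod t n' v' (onhead 2 F)
  end.

Lemma ones_prodSS (S : comNzRingType) (t : S) n v F :
  ones_prod t n.+1 v.+1 F =
      ones_prod t n v.+1 (fun w => F (1%N :: w))
      + ones_prod t n.+1 v (fun w => F (1%N :: w))
      + (1 - 2%:R * t) * ones_prod t n v (fun w => F (2%N :: w))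
      + (t ^+ 2 - t) * ones_prod t n v (onhead 2 F).
Proof. by []. Qed.

Lemma ones_prodn0 (S : comNzRingType) (t : S) n F :
  ones_prod t n 0 F = F (nseq n 1%N).
Proof. by elim: n F => //= n IHn F; rewrite IHn. Qed.

Lemma ones_prodC (S : comNzRingType) (t : S) n v F :
  ones_prod t n v F = ones_prod t v n F.
Proof.
elim: n v F => [|n IHn]; first by elim=> //= v IHv F; rewrite IHv.
elim=> [|v IHv] F; first by rewrite /= IHn.
by rewrite !ones_prodSS !(IHn v) IHn IHv; congr (_ + _ + _); rewrite addrC.
Qed.

Lemma ones_prod_lin (S : comNzRingType) (t : S) n v :
  lin_functional (ones_prod t n v).
Proof.
elim: n v => [|n IHn]; first by elim=> //= v IHv c F G; rewrite IHv.
elim=> [|v IHv] c F G; first by rewrite /= IHn.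
by rewrite !ones_prodSS onhead_lin !IHn IHv; ring.
Qed.

(** [stuffle] with k = l = 1; its three shorter products come from the two inductions. *)
Lemma ones_prodP (S : comNzRingType) (t : S) x A :
    interpolated_sums t x A ->
  forall n v M, A M (nseq n 1%N) * A M (nseq v 1%N) = ones_prod t n v (A M).
Proof.
move=> hA; have [A1 _ _] := hA.
elim=> [|n IHn] v; first by move=> M; rewrite A1 mul1r ones_prodC ones_prodn0.
elim: v => [|v IHv] M; first by rewrite A1 mulr1 ones_prodn0.
rewrite ones_prodSS; apply: (@stuffle _ _ _ _ (ones_prod t n v.+1)
  (ones_prod t n.+1 v) _ 1 1 (nseq n 1%N) (nseq v 1%N) hA); try exact: ones_prod_lin.
- exact: (IHn v.+1).
- exact: IHv.
- exact: IHn.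
Qed.

(* The combination z_1^n * z_u z_1^v; l counts the letters 1 that come first. *)
Definition one_run_prod (S : comNzRingType) (t : S) u n v (F : seq nat -> S) :=
  ones_prod t v n (fun w => F (u :: w))
  + \sum_(1 <= l < n.+1)
     ones_prod t v (n - l) (fun w =>
        F (nseq l 1%N ++ u :: w)
        + (1 - 2%:R * t) * F (nseq (l - 1) 1%N ++ (u + 1)%N :: w)
        + (t ^+ 2 - t) *
            onhead (u + 1) (fun w' => F (nseq (l - 1) 1%N ++ w')) w).

(** Recasts the sum over l as the recursion required by [stuffle]: the summand l = 1 gives the last
    two terms and, with those for l >= 2, the product for n behind a leading 1. *)
Lemma one_run_prodS (S : comNzRingType) (t : S) u n v F :
  one_run_prod t u n.+1 v F =
    one_run_prod t u n v (fun w => F (1%N :: w))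
    + ones_prod t v n.+1 (fun w => F (u :: w))
    + (1 - 2%:R * t) * ones_prod t v n (fun w => F ((u + 1)%N :: w))
    + (t ^+ 2 - t) * ones_prod t v n (onhead (u + 1) F).
Proof.
have hE := ones_prod_lin t v.
rewrite /one_run_prod big_nat_recl // subSS subn0 /=.
rewrite (lin_functionalD _ _ (hE n)) (lin_functionalD _ _ (hE n)).
rewrite !(lin_functionalZ _ _ (hE n)).
rewrite [in LHS](eq_big_nat _ _ (F2 := fun l =>
     ones_prod t v (n - l) (fun w =>
        F (1%N :: nseq l 1%N ++ u :: w)
        + (1 - 2%:R * t) * F (1%N :: nseq (l - 1) 1%N ++ (u + 1)%N :: w)
        + (t ^+ 2 - t) *
            onhead (u + 1) (fun w' => F (1%N :: nseq (l - 1) 1%N ++ w')) w))).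
  by rewrite /onhead; ring.
by move=> [|l] // _; rewrite !subSS !subn0.
Qed.

Lemma one_run_prod_lin (S : comNzRingType) (t : S) u n v :
  lin_functional (one_run_prod t u n v).
Proof.
elim: n => [|n IHn] c F G.
  by rewrite /one_run_prod !big_geq // !addr0 ones_prod_lin.
by rewrite !one_run_prodS IHn onhead_lin !ones_prod_lin; ring.
Qed.

Lemma one_run_prodP (S : comNzRingType) (t : S) x A :
    interpolated_sums t x A ->
  forall u n v M,
  A M (nseq n 1%N) * A M (u :: nseq v 1%N) = one_run_prod t u n v (A M).
Proof.
move=> hA u n v; have [A1 _ _] := hA; elim: n => [|n IHn] M.
  by rewrite A1 mul1r /one_run_prod big_geq // addr0 ones_prodn0.
rewrite one_run_prodS addnC.
apply: (@stuffle _ _ _ _ _ _ _ 1 u (nseq n 1%N) (nseq v 1%N) hA) => //.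
- exact: one_run_prod_lin.
- exact: ones_prod_lin.
- exact: ones_prod_lin.
- by move=> M'; rewrite mulrC (ones_prodP hA v n.+1).
- by move=> M'; rewrite mulrC (ones_prodP hA).
Qed.

Lemma two_runs_prodP (S : comNzRingType) (t : S) x A :
    interpolated_sums t x A ->
  forall m u n v M,
  A M (m :: nseq n 1%N) * A M (u :: nseq v 1%N) =
    one_run_prod t u n v (fun w => A M (m :: w))
    + one_run_prod t m v n (fun w => A M (u :: w))
    + (1 - 2%:R * t) * ones_prod t n v (fun w => A M ((m + u)%N :: w))
    + (t ^+ 2 - t) * ones_prod t n v (onhead (m + u) (A M)).
Proof.
move=> hA m u n v; apply: (@stuffle _ _ _ _ (one_run_prod t u n v)
  (one_run_prod t m v n) (ones_prod t n v) m u (nseq n 1%N) (nseq v 1%N) hA).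
- exact: one_run_prod_lin.
- exact: one_run_prod_lin.
- exact: ones_prod_lin.
- exact: (one_run_prodP hA u n v).
- by move=> M; rewrite mulrC; exact: (one_run_prodP hA m v n).
- exact: (ones_prodP hA n v).
Qed.

(** * Closed form of z_1^n * z_1^v *)

Definition half_sum (a : seq nat) : nat := sumn [seq x./2 | x <- a].
Definition evens (a : seq nat) : nat := count (predC odd) a.

(** Each entry x satisfies x + [x is even] = 1 + 2 floor(x/2). Hence, for a tuple of sum M with j
    even entries, i + j = k and N = M - i - k force k = [half_sum a]. *)
Lemma sumn_evens a : (sumn a + evens a = size a + 2 * half_sum a)%N.
Proof.
by elim: a => //= x a; rewrite /evens /half_sum /=; have := odd_double_half x; lia.
Qed.

Lemma evens_le a : all (leq 1) a -> (evens a <= half_sum a)%N.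
Proof.
elim: a => //= x a IHa /andP[x0 /IHa]; rewrite /evens /half_sum /=.
by have := odd_double_half x; lia.
Qed.

(** Mirrors the recursion of [ones_prod]: a head is 1, is 2, or exceeds 2 and comes from a nonempty
    composition of W - 2 by adding 2 to its head. *)
Fixpoint compositions (W : nat) : seq (seq nat) :=
  match W with
  | 0 => [:: [::]]
  | W1.+1 => [seq 1%N :: a | a <- compositions W1] ++
      (if W1 is W2.+1 then
         [seq 2%N :: a | a <- compositions W2] ++
         [seq (head 0%N a).+2 :: behead a | a <- compositions W2 & a != [::]]
       else [::])
  end.

Lemma mem_compositions W a : (a \in compositions W) = all (leq 1) a && (sumn a == W).
Proof.
elim/ltn_ind: W a => -[|W] IHW a.
  by rewrite inE; case: a => // -[|x] a //=; rewrite addSn andbF.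
rewrite /= mem_cat; apply/orP/andP.
- case=> [/mapP[b]|].
    by rewrite IHW // => /andP[b1 /eqP <-] ->.
  case: W IHW => // W IHW; rewrite mem_cat => /orP[] /mapP[b].
    by rewrite IHW // => /andP[b1 /eqP <-] ->.
  rewrite mem_filter IHW //; case: b => // x b /= /andP[/andP[x1 b1] /eqP xb] ->.
  by rewrite /= b1; split=> //; lia.
- case: a => [|[|[|x]] a] /= [] // a1 /eqP // aW.
    left; apply/map_f; rewrite IHW // a1; lia.
  right; case: W IHW aW => [|W] IHW aW; first by lia.
  rewrite mem_cat; apply/orP; case: x aW => [|x] aW; [left|right].
    by apply/map_f; rewrite IHW // a1; lia.
  apply/mapP; exists (x.+1 :: a) => //.
  by rewrite mem_filter IHW //= a1; lia.
Qed.

Lemma uniq_compositions W : uniq (compositions W).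
Proof.
elim/ltn_ind: W => -[|W] IHW //=; rewrite cat_uniq.
rewrite map_inj_uniq ?IHW //=; last by move=> ? ? [].
case: W IHW => //= W IHW.
apply/andP; split.
  apply/hasPn => a; rewrite mem_cat => /orP[] /mapP[b _ ->]; apply/mapP => -[c _] //.
rewrite cat_uniq map_inj_uniq ?IHW //=; last by move=> ? ? [].
apply/andP; split.
  (* Positive entries separate the last two blocks: a head x + 2 with x >= 1 is never 2. *)
  apply/hasPn => a /mapP[b]; rewrite mem_filter mem_compositions.
  by case: b => // -[|x] b // _ ->; apply/mapP => -[c _].
rewrite map_inj_in_uniq; first by rewrite filter_uniq // IHW.
by move=> [|x a] [|y b]; rewrite !mem_filter //= => _ _ [-> ->].
Qed.

Lemma big_compositionsS (S : nmodType) W (G : seq nat -> S) :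
  \sum_(a <- compositions W.+1) G a = \sum_(a <- compositions W) G (1%N :: a)
    + (if W is W'.+1 then \sum_(a <- compositions W') (G (2%N :: a) + onhead 2 G a)
       else 0).
Proof.
rewrite big_cat big_map; congr (_ + _); case: W => [|W]; first by rewrite big_nil.
rewrite big_cat !big_map big_split; congr (_ + _).
by rewrite big_filter big_mkcond; apply: eq_bigr => -[].
Qed.

(** With K = [half_sum a] and j = [evens a], the exponents are i = K - j and j. The guard matters:
    for K > n truncated subtraction would turn the binomial into C(_, 0) = 1. *)
Definition ones_coef (S : comNzRingType) (t : S) n v a : S :=
  if (half_sum a <= minn n v)%N then
    'C(v + n - 2 * half_sum a, n - half_sum a)%:R
    * (t ^+ 2 - t) ^+ (half_sum a - evens a) * (1 - 2%:R * t) ^+ evens a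
  else 0.

Lemma ones_coefC (S : comNzRingType) (t : S) n v a :
  ones_coef t n v a = ones_coef t v n a.
Proof.
rewrite /ones_coef minnC; case: ifP => // ha.
rewrite [in RHS](addnC n) -bin_sub; last by lia.
by do 4 f_equal; lia.
Qed.

Lemma ones_coef_n0 (S : comNzRingType) (t : S) n a :
  ones_coef t n 0 (1%N :: a) = if half_sum a == 0%N then
     (t ^+ 2 - t) ^+ (half_sum a - evens a) * (1 - 2%:R * t) ^+ evens a else 0.
Proof.
rewrite /ones_coef minn0 leqn0.
rewrite (_ : half_sum (1%N :: a) = half_sum a) // (_ : evens (1%N :: a) = evens a) //.
by case: eqP => // ->; rewrite add0n !subn0 binn mul1r.
Qed.

(** A leading 1 changes neither K nor j, so this is Pascal's rule, with boundary cases K = n + 1 and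
    K = v + 1. *)
Lemma ones_coef1 (S : comNzRingType) (t : S) n v a :
  sumn a = (n + v).+1 ->
  ones_coef t n.+1 v.+1 (1%N :: a) = ones_coef t n v.+1 a + ones_coef t n.+1 v a.
Proof.
have := sumn_evens a; have : (evens a <= size a)%N by exact: count_size.
rewrite /ones_coef.
rewrite (_ : half_sum (1%N :: a) = half_sum a) // (_ : evens (1%N :: a) = evens a) //.
move: (half_sum a) (evens a) (size a) => K j N jN aN sa.
have [Kbig|Ksmall] := boolP (minn n.+1 v.+1 < K)%N.
  by do 3 (rewrite ifF; last by lia); rewrite addr0.
(* K = n + 1 = v + 1 would give j = N + 1 by [sumn_evens], more even entries than entries; here the
   value of [sumn a] enters. *)
case: (leqP K n) => Kn; case: (leqP K v) => Kv; last by lia.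
- do 3 (rewrite ifT; last by lia).
  rewrite (_ : (v.+1 + n.+1 - 2 * K = (v.+1 + n - 2 * K).+1)%N); last by lia.
  rewrite (subSn Kn) binS (_ : (v + n.+1 - 2 * K = v.+1 + n - 2 * K)%N); last by lia.
  by rewrite natrD; ring.
(* K = v + 1: the guard kills the second term on the right and the other two binomials are 1. The
   case K = n + 1 below is its mirror image. *)
- rewrite ifT; last by lia.
  rewrite ifT; last by lia.
  rewrite ifF; last by lia.
  rewrite (_ : (v.+1 + n.+1 - 2 * K = n.+1 - K)%N); last by lia.
  rewrite (_ : (v.+1 + n - 2 * K = n - K)%N); last by lia.
  by rewrite !binn addr0.
- rewrite ifT; last by lia.
  rewrite ifF; last by lia.
  rewrite ifT; last by lia.
  rewrite (_ : (n.+1 - K = 0)%N); last by lia.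
  by rewrite !bin0 add0r.
Qed.

Lemma ones_coef2 (S : comNzRingType) (t : S) n v a :
  ones_coef t n.+1 v.+1 (2%N :: a) = (1 - 2%:R * t) * ones_coef t n v a.
Proof.
rewrite /ones_coef.
rewrite (_ : half_sum (2%N :: a) = (half_sum a).+1) // (_ : evens (2%N :: a) = (evens a).+1) //.
rewrite minnSS ltnS; case: ifP => _; last by rewrite mulr0.
rewrite (_ : v.+1 + n.+1 - 2 * (half_sum a).+1 = v + n - 2 * half_sum a)%N; last by lia.
rewrite !subSS (exprS (1 - _)).
by ring.
Qed.

(** The parity of the head is kept, so K grows by 1 at fixed j and the extra factor is t^2 - t. By
    [evens_le] the exponent K - j is not truncated. *)
Lemma ones_coef_add2 (S : comNzRingType) (t : S) n v x a : all (leq 1) (x :: a) ->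
  ones_coef t n.+1 v.+1 (x.+2 :: a) = (t ^+ 2 - t) * ones_coef t n v (x :: a).
Proof.
move=> /evens_le; rewrite /ones_coef.
rewrite (_ : half_sum (x.+2 :: a) = (half_sum (x :: a)).+1) //.
rewrite (_ : evens (x.+2 :: a) = evens (x :: a)); last by rewrite /evens /= negbK.
move=> aK; rewrite minnSS ltnS; case: ifP => _; last by rewrite mulr0.
rewrite (_ : v.+1 + n.+1 - 2 * (half_sum (x :: a)).+1 =
             v + n - 2 * half_sum (x :: a))%N; last by lia.
rewrite subSS subSn // (exprS (_ - _)).
by ring.
Qed.

(** Both sides obey the same recursion: [ones_coef1], [ones_coef2] and [ones_coef_add2] are the
    steps of [ones_prod] read on the coefficients of words with head 1, 2 and at least 3. *)
Lemma ones_prod_compositions (S : comNzRingType) (t : S) n v F :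
  ones_prod t n v F = \sum_(a <- compositions (n + v)) ones_coef t n v a * F a.
Proof.
have base k G : ones_prod t k 0 G = \sum_(a <- compositions (k + 0)) ones_coef t k 0 a * G a.
  elim: k G => [|k IHk] G.
    by rewrite /= big_seq1 /ones_coef /= bin0 !mul1r.
  rewrite addSn big_compositionsS /= IHk [X in _ = _ + X](_ : _ = 0) ?addr0.
    apply: eq_bigr => a _; congr (_ * _).
    rewrite ones_coef_n0 /ones_coef minn0 leqn0; case: eqP => // ->.
    by rewrite !subn0 binn mul1r.
  (* For v = 0 the guard forces K = 0, so words with a head of at least 2 get coefficient 0. *)
  case: k {IHk} => [|k] //=; rewrite big1 // => a _.
  by case: a => [|x a]; rewrite /onhead /ones_coef minn0 !mul0r addr0.
elim: n v F => [|n IHn] v F.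
  rewrite ones_prodC base addnC; apply: eq_bigr => a _.
  by rewrite ones_coefC.
elim: v F => [|v IHv] F; first exact: base.
rewrite ones_prodSS !IHn IHv (addSn n v.+1) !(addnS n v) (addSn n v) [in RHS]big_compositionsS.
rewrite -big_split !mulr_sumr -addrA -big_split.
congr (_ + _); apply: eq_big_seq => a; rewrite mem_compositions => /andP[a1 /eqP sa] /=.
  by rewrite ones_coef1 // mulrDl.
rewrite ones_coef2 !mulrA; congr (_ + _).
case: a a1 {sa} => [|x a] a1; first by rewrite /= mulr0.
by rewrite /onhead ones_coef_add2 // mulrA.
Qed.

Lemma sum_tuplesA_compositions (S : nmodType) N M j (G : seq nat -> S) :
  \sum_(a <- tuplesA N M j) G a =
  \sum_(a <- compositions M | (size a == N) && (evens a == j)) G a.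
Proof.
rewrite -[RHS]big_filter; apply: perm_big; apply: uniq_perm.
- exact: uniq_tuplesA.
- exact/filter_uniq/uniq_compositions.
- move=> a; rewrite mem_tuplesA mem_filter mem_compositions /evens.
  by case: (size a == N); rewrite //= andbA andbC.
Qed.

Lemma compositions_size a W : a \in compositions W ->
  (W + evens a = size a + 2 * half_sum a)%N /\ (evens a <= half_sum a)%N.
Proof.
by rewrite mem_compositions => /andP[a1 /eqP <-]; split; [exact: sumn_evens|exact: evens_le].
Qed.

(** A composition [a] can only occur for j = [evens a], k = [half_sum a] and i = k - j, and this k
    is in range exactly when the guard of [ones_coef] holds. After the exchange of sums, those over
    j, i and k collapse in turn. *)
Lemma sum_tuplesA_ones_prod (S : comNzRingType) (t : S) n v (F : seq nat -> S) :
  \sum_(0 <= k < (minn n v).+1)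
    \sum_(0 <= i < k.+1) \sum_(0 <= j < k.+1 | (i + j == k)%N)
    \sum_(a <- tuplesA (v + n - i - k) (n + v) j)
      'C(v + n - 2 * k, n - k)%:R
      * (t ^+ 2 - t) ^+ i * (1 - 2%:R * t) ^+ j * F a =
  ones_prod t n v F.
Proof.
pose X k i j a : S := 'C(v + n - 2 * k, n - k)%:R
      * (t ^+ 2 - t) ^+ i * (1 - 2%:R * t) ^+ j * F a.
transitivity (\sum_(a <- compositions (n + v)) \sum_(0 <= k < (minn n v).+1)
    \sum_(0 <= i < k.+1) \sum_(0 <= j < k.+1 | (i + j == k)%N)
    if (size a == v + n - i - k)%N && (evens a == j) then X k i j a else 0).
  rewrite exchange_big; apply: eq_bigr => k _.
  rewrite exchange_big; apply: eq_bigr => i _.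
  rewrite exchange_big; apply: eq_bigr => j _.
  by rewrite sum_tuplesA_compositions big_mkcond.
rewrite ones_prod_compositions; apply: eq_big_seq => a /compositions_size[aW aj].
transitivity (\sum_(0 <= k < (minn n v).+1 | k == half_sum a)
    X k (k - evens a)%N (evens a) a); last first.
  rewrite big_nat1_eq /ones_coef ltnS /=; case: ifP => // _.
  by rewrite mul0r.
rewrite [RHS]big_mkcond; apply: eq_big_nat => k /andP[_ kmin].
transitivity (\sum_(0 <= i < k.+1)
    if (i == k - evens a)%N && (k == half_sum a) then
      X k i (evens a) a else 0).
  apply: eq_big_nat => i /andP[_ ik].
  under eq_bigr do rewrite andbC.
  transitivity (\sum_(0 <= j < k.+1 | j == evens a)
    if (i + j == k)%N && (size a == v + n - i - k)%N then X k i j a else 0).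
    rewrite big_mkcond [RHS]big_mkcond; apply: eq_bigr => j _.
    rewrite (eq_sym (evens a)).
    by case: (i + j == k)%N; case: (j == evens a); case: (size a == _).
  rewrite big_nat1_eq; case: ifP => evk.
    (* Given i + j = k, the condition on [size a] amounts to k = [half_sum a] by [aW]. *)
    by congr (if _ then _ else _); lia.
  by rewrite ifF //; lia.
case: eqP => [->|_]; last by rewrite big1 // => i _; rewrite andbF.
under eq_bigr do rewrite andbT.
by rewrite -big_mkcond big_nat1_eq ifT //; lia.
Qed.

(** * Convergence of the truncated sums *)

Fixpoint zeta_trunc (R : realType) (M : nat) (k : seq nat) : R :=
  match k, M with
  | [::], _ => 1
  | k1 :: ks, M'.+1 =>
      zeta_trunc R M' k + M%:R^-1 ^+ k1 * zeta_trunc R M' ks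
  | _ :: _, 0 => 0
  end.

Lemma zeta_trunc_nil (R : realType) M : zeta_trunc R M [::] = 1.
Proof. by case: M. Qed.

Lemma zeta_truncS (R : realType) M k ks : zeta_trunc R M.+1 (k :: ks) =
  zeta_trunc R M (k :: ks) + M.+1%:R^-1 ^+ k * zeta_trunc R M ks.
Proof. by []. Qed.

Lemma zeta_trunc_ge0 (R : realType) M k : 0 <= zeta_trunc R M k.
Proof.
by elim: M k => [|M IHM] [|k ks] //; rewrite zeta_truncS addr_ge0 // mulr_ge0.
Qed.

Lemma zeta_trunc_nondecreasing (R : realType) k :
  nondecreasing_seq (zeta_trunc R ^~ k).
Proof.
apply/nondecreasing_seqP => M; case: k => [|k ks]; first by rewrite !zeta_trunc_nil.
by rewrite zeta_truncS lerDl mulr_ge0 ?zeta_trunc_ge0 // exprn_ge0 // invr_ge0 ler0n.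
Qed.

Lemma zeta_trunc_le (R : realType) M p q :
  all2 leq q p -> zeta_trunc R M p <= zeta_trunc R M q.
Proof.
elim: M p q => [|M IHM] [|k p] [|l q] // /[dup] lkqp /= /andP[lk qp].
rewrite lerD //; first exact: (IHM (k :: p) (l :: q)).
apply: ler_pM; rewrite ?zeta_trunc_ge0 ?exprn_ge0 ?invr_ge0 ?ler0n //; last exact: IHM.
by rewrite ler_wiXn2l ?invr_ge0 ?ler0n // invf_le1 ?ltr0n // ler1n.
Qed.

(* With S_j(M) the truncation of zeta({1}^j), the quantity
   zeta_M(2,{1}^n) + M^-1 * \sum_(j <= n) S_j(M) does not increase with M. *)
Lemma zeta_trunc_2ones_bounded (R : realType) n :
  exists C, forall M, zeta_trunc R M (2%N :: nseq n 1%N) <= C.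
Proof.
pose T N M : R := \sum_(0 <= j < N) zeta_trunc R M (nseq j 1%N).
have T_ge0 N M : 0 <= T N M by rewrite sumr_ge0 // => j _; rewrite zeta_trunc_ge0.
have TS M : T n.+1 M.+1 = T n.+1 M + M.+1%:R^-1 * T n M.
  rewrite /T [LHS]big_nat_recl // [in X in _ = X + _]big_nat_recl // !zeta_trunc_nil.
  by rewrite -addrA mulr_sumr -big_split.
have Trecr M : T n.+1 M = T n M + zeta_trunc R M (nseq n 1%N).
  by rewrite /T big_nat_recr.
pose F M : R := zeta_trunc R M (2%N :: nseq n 1%N) + M%:R^-1 * T n.+1 M.
(* The comparison starts at M = 1, since [F 0] is 0 by the convention 0^-1 = 0. *)
have F1 M : F M.+1 <= F 1%N.
  elim: M => // M; apply: le_trans.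
  rewrite /F (zeta_truncS _ M.+1) TS !Trecr (_ : M.+2%:R = M.+1%:R + 1); last first.
    by rewrite -[in LHS]addn1 natrD.
  have : (1 : R) <= M.+1%:R by rewrite ler1n.
  move: (M.+1%:R : R) (T n M.+1) (T_ge0 n M.+1) => y T' T0 y1.
  have := zeta_trunc_ge0 R M.+1 (nseq n 1%N).
  move: (zeta_trunc _ _ (nseq n _)) (zeta_trunc _ _ (_ :: _)) => s w s0.
  have y0 : y != 0 by apply/eqP; lra.
  have z0 : y + 1 != 0 by apply/eqP; lra.
  rewrite -subr_ge0.
  (* From y to y + 1 the gains are (T' + s) / (y + 1)^2, less than the loss (T' + s) (1/y - 1/(y +
     1)) unless T' + s = 0. *)
  rewrite (_ : _ - _ = (T' + s) / (y * (y + 1) ^+ 2)); last by field; rewrite y0 z0.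
  by rewrite divr_ge0 ?addr_ge0 ?mulr_ge0 ?exprn_ge0 //; lra.
exists (F 1%N) => -[|M]; first by rewrite addr_ge0 ?zeta_trunc_ge0 // mulr_ge0 // invr_ge0.
apply: le_trans (F1 M); rewrite /F lerDl mulr_ge0 // invr_ge0 ler0n //.
Qed.

Definition admissible (k : seq nat) := (2 <= head 0 k)%N && all (leq 1) k.

(** Entry by entry the index dominates (2, {1}^r) with r = [size ks], and larger exponents only
    shrink the sums. *)
Lemma zeta_trunc_bounded (R : realType) k : admissible k ->
  exists C, forall M, zeta_trunc R M k <= C.
Proof.
case: k => // k ks /andP[/= k2 /andP[_ ks1]].
have [C hC] := zeta_trunc_2ones_bounded R (size ks).
exists C => M; apply: le_trans (hC M); apply: zeta_trunc_le => /=.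
by rewrite k2; elim: ks ks1 {C hC} => //= l ks IH /andP[-> /IH].
Qed.

(** * Truncations as partial sums of the infinite series *)

Fixpoint decreasing_seqs (M n : nat) : seq (seq nat) :=
  match n, M with
  | 0, _ => [:: [::]]
  | n'.+1, M'.+1 =>
      decreasing_seqs M' n ++ [seq M :: s | s <- decreasing_seqs M' n']
  | _.+1, 0 => [::]
  end.

Lemma mem_decreasing_seqs M n s : (s \in decreasing_seqs M n) =
  [&& size s == n, sorted gtn s, all (leq 1) s & all (geq M) s].
Proof.
elim: M n s => [|M IHM] [|n] s; try by rewrite inE; case: s.
  by case: s => [|[|x] s] //; rewrite /= !andbF.
rewrite mem_cat IHM; case: s => [|x s] /=.
  by apply/mapP => -[].
rewrite !path_sortedE; last by move=> a b c; rewrite /= => ab ca; lia.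
rewrite eqSS; apply/orP/idP.
- case=> [/and5P[-> /andP[-> ->] -> /= xM sM]|/mapP[s']].
    by rewrite ltnW //=; apply: sub_all sM => y /= ?; lia.
  rewrite IHM => /and4P[sn ss s1 sM] [-> ->]; rewrite sn ss s1 leqnn !andbT /=.
  by apply/andP; split; apply: sub_all sM => y /= ?; lia.
- case/and4P=> sn /andP[sx ss] /andP[x1 s1] /andP[xM sM].
  move: xM; rewrite leq_eqVlt => /orP[/eqP xM|xM]; [right|left].
    rewrite xM; apply: map_f; rewrite IHM sn ss s1 /=.
    by apply: sub_all sx => y /= ?; lia.
  rewrite sn sx ss x1 s1 -ltnS xM /=.
  by apply: sub_all sx => y /= ?; lia.
Qed.

Lemma uniq_decreasing_seqs M n : uniq (decreasing_seqs M n).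
Proof.
elim: M n => [|M IHM] [|n] //=; rewrite cat_uniq IHM map_inj_uniq ?IHM /= ?andbT.
  2: by move=> ? ? [].
apply/hasPn => s /mapP[s' _ ->].
by rewrite mem_decreasing_seqs /= ltnn !andbF.
Qed.

Definition zeta_term (R : realType) (k m : seq nat) : R :=
  \prod_(i < size k) ((nth 0%N m i)%:R ^+ nth 0%N k i)^-1.

Lemma zeta_term_ge0 (R : realType) k m : 0 <= zeta_term R k m.
Proof. by apply: prodr_ge0 => i _; rewrite invr_ge0 exprn_ge0 ?ler0n. Qed.

Lemma zeta_truncE (R : realType) M k :
  zeta_trunc R M k = \sum_(m <- decreasing_seqs M (size k)) zeta_term R k m.
Proof.
elim: M k => [|M IHM] [|k ks]; try by rewrite /= big_seq1 /zeta_term big_ord0.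
  by rewrite /= big_nil.
rewrite zeta_truncS !IHM big_cat big_map mulr_sumr; congr (_ + _).
by apply: eq_bigr => m _; rewrite [RHS]/zeta_term big_ord_recl exprVn.
Qed.

(** The finite sets [decreasing_seqs M (size k)] exhaust the index set, so the supremum over all
    finite subsets can be taken along them. *)
Lemma zeta_esum (R : realType) k :
  (\esum_(m in [set m : seq nat |
        [/\ size m = size k, sorted gtn m & all (leq 1) m]])
     (zeta_term R k m)%:E)%E =
  ereal_sup (range (fun M => (zeta_trunc R M k)%:E)).
Proof.
have truncE M : (zeta_trunc R M k)%:E =
    (\sum_(m \in [set` decreasing_seqs M (size k)]) (zeta_term R k m)%:E)%E.
  by rewrite zeta_truncE -sumEFin fsbig_seq ?uniq_decreasing_seqs.
apply/eqP; rewrite eq_le; apply/andP; split.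
- apply: ge_ereal_sup => _ [X [Xfin Xk] <-].
  have [r rX] := (finite_seqP X).1 Xfin.
  (* The sum of the entries is a crude bound for each of them, so all sequences in [X] have entries
     at most [M]. *)
  pose M := \max_(m <- r) sumn m.
  apply: (@le_trans _ _ (zeta_trunc R M k)%:E); last first.
    by apply: ereal_sup_ubound; exists M.
  rewrite truncE; apply: lee_fsum_nneg_subset => //; first exact: finite_seq.
  + move=> m; rewrite !inE => Xm.
    have [sm dm pm] := Xk _ Xm.
    rewrite /= mem_decreasing_seqs sm eqxx dm pm /=.
    have : (sumn m <= M)%N.
      by apply: leq_bigmax_seq => //; move: Xm; rewrite rX.
    elim: (m) => //= x s IHs xsM.
    by rewrite IHs ?andbT; lia.
  + by move=> m _; rewrite lee_fin zeta_term_ge0.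
- apply: ge_ereal_sup => _ [M _ <-]; rewrite truncE; apply: esum_ge.
  exists [set` decreasing_seqs M (size k)]%classic => //; split=> [|m]; first exact: finite_seq.
  by rewrite /= mem_decreasing_seqs => /and4P[/eqP].
Qed.

(** Boundedness makes the supremum a real number, which [fine] then returns; a bounded monotone
    sequence converges to it. *)
Lemma zeta_trunc_cvg (R : realType) k : admissible k ->
  (zeta_trunc R M k @[M --> \oo] --> zeta R k)%classic.
Proof.
move=> /(zeta_trunc_bounded R)[C hC].
have ub : has_ubound (range (zeta_trunc R ^~ k)) by exists C => _ [M _ <-].
rewrite /zeta zeta_esum -[fun M => _%:E]/(EFin \o (zeta_trunc R ^~ k)) -image_comp.
rewrite ereal_sup_EFin //=; last by exists (zeta_trunc R 0 k), 0%N.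
by apply: nondecreasing_cvgn => //; exact: zeta_trunc_nondecreasing.
Qed.

(** * Passage to the limit *)

Lemma big_bool_tupleS (S : nmodType) n (F : bitseq -> S) :
  \sum_(b : n.+1.-tuple bool) F b =
  \sum_(b : n.-tuple bool) F (false :: b) + \sum_(b : n.-tuple bool) F (true :: b).
Proof.
rewrite addrC -(big_bool _ (fun x => \sum_(b : n.-tuple bool) F (x :: b))) pair_bigA /=.
rewrite (reindex (fun p : bool * n.-tuple bool => [tuple of p.1 :: p.2])) //=.
exists (fun b => (thead b, [tuple of behead b])) => [[x b]|b] _.
  by rewrite theadE; congr (_, _); exact: val_inj.
by rewrite [b in RHS]tuple_eta.
Qed.

(** [zetat] with an arbitrary [Z] for [zeta R]: it is applied to truncations and, when the first box
    is a comma, to p |-> Z (k :: p). *)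
Definition interpolate (R : nzRingType) (Z : seq nat -> R) (k : seq nat) : {poly R} :=
  if k is k1 :: ks then
    \sum_(b : (size ks).-tuple bool)
      let p := fill_boxes k1 ks b in 'X^(size k - size p) * (Z p)%:P
  else 1.

Lemma size_fill_boxes k ks b : (size (fill_boxes k ks b) <= (size ks).+1)%N.
Proof.
by elim: ks k b => [|l ks IH] k [|[] b] //=; [apply: leqW|]; exact: IH.
Qed.

Lemma interpolate1 (R : nzRingType) (Z : seq nat -> R) k :
  interpolate Z [:: k] = (Z [:: k])%:P.
Proof.
rewrite /interpolate (big_pred1 [tuple]) /=; first by rewrite subnn mul1r.
by move=> b; apply/esym/eqP; exact: tuple0.
Qed.

Lemma interpolate_cons2 (R : nzRingType) (Z : seq nat -> R) k l ks :
  interpolate Z [:: k, l & ks] =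
    interpolate (fun p => Z (k :: p)) (l :: ks) + 'X * interpolate Z ((k + l)%N :: ks).
Proof.
rewrite /interpolate; set F := fun b : bitseq =>
  let p := fill_boxes k (l :: ks) b in 'X^(size [:: k, l & ks] - size p) * (Z p)%:P.
rewrite (@big_bool_tupleS _ _ F) mulr_sumr; congr (_ + _); apply: eq_bigr => b _.
by rewrite /F /= subSn ?size_fill_boxes // exprS mulrA.
Qed.

(** Stated for nonempty indices: at [[::]] the value is 1 whatever [Z] is. *)
Lemma interpolate_lin (R : comNzRingType) (Z1 Z2 : seq nat -> R) c k ks :
  interpolate (fun p => Z1 p + c * Z2 p) (k :: ks) =
  interpolate Z1 (k :: ks) + c%:P * interpolate Z2 (k :: ks).
Proof.
rewrite /interpolate mulr_sumr -big_split; apply: eq_bigr => b _ /=.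
by rewrite polyCD polyCM; ring.
Qed.

(** In passing from M - 1 to M with w nonempty, a comma in the first box adds M^-k A_(M-1)(w), and a
    plus sign adds t M^-k (A_M(w) - A_(M-1)(w)). A plus sign changes the head, so the induction on
    [w] is for all k. *)
Lemma interpolate_truncP (R : realType) :
  interpolated_sums ('X : {poly R}) (fun M => (M%:R^-1)%:P)
    (fun M => interpolate (zeta_trunc R M)).
Proof.
split=> // [k w|M k w].
  elim: w k => [|l w IHw] k; first by rewrite interpolate1.
  rewrite interpolate_cons2 IHw mulr0 addr0 /interpolate big1 // => b _.
  by rewrite mulr0.
elim: w k => [|l w IHw] k.
  rewrite !interpolate1 zeta_truncS zeta_trunc_nil /=.
  by rewrite polyCD mulr1 polyC_exp; ring.
rewrite !interpolate_cons2 IHw -polyC_exp.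
under [X in interpolate X]eq_fun do rewrite zeta_truncS.
rewrite interpolate_lin (IHw l) exprD polyCM !polyC_exp.
ring.
Qed.

Definition coef_cvg (R : realType) (f : nat -> {poly R}) (l : {poly R}) :=
  forall i, ((f M)`_i @[M --> \oo] --> l`_i)%classic.

Lemma coef_cvg_unique (R : realType) f (l1 l2 : {poly R}) :
  coef_cvg f l1 -> coef_cvg f l2 -> l1 = l2.
Proof. by move=> f1 f2; apply/polyP => i; exact: (cvg_unique _ (f1 i) (f2 i)). Qed.

Lemma coef_cvg_cst (R : realType) (l : {poly R}) : coef_cvg (fun=> l) l.
Proof. by move=> i; exact: cvg_cst. Qed.

Lemma coef_cvgD (R : realType) f g (a b : {poly R}) :
  coef_cvg f a -> coef_cvg g b -> coef_cvg (fun M => f M + g M) (a + b).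
Proof.
move=> fa gb i; rewrite coefD; under eq_fun do rewrite coefD.
exact: cvgD (fa i) (gb i).
Qed.

Lemma coef_cvgM (R : realType) f g (a b : {poly R}) :
  coef_cvg f a -> coef_cvg g b -> coef_cvg (fun M => f M * g M) (a * b).
Proof.
move=> fa gb i; rewrite coefM; under eq_fun do rewrite coefM.
apply: cvg_big => [|j _]; first exact: add_continuous.
exact: cvgM (fa _) (gb _).
Qed.

Lemma coef_cvg_sum (R : realType) (I : eqType) (r : seq I)
    (f : nat -> I -> {poly R}) (a : I -> {poly R}) :
  (forall i, i \in r -> coef_cvg (f ^~ i) (a i)) ->
  coef_cvg (fun M => \sum_(i <- r) f M i) (\sum_(i <- r) a i).
Proof.
elim: r => [|x r IHr] fa.
  by rewrite big_nil; under eq_fun do rewrite big_nil; exact: coef_cvg_cst.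
rewrite big_cons; under eq_fun do rewrite big_cons.
apply: coef_cvgD; first by apply: fa; rewrite mem_head.
by apply: IHr => i ir; apply: fa; rewrite inE ir orbT.
Qed.

Lemma fill_boxes_admissible k ks b :
  admissible (k :: ks) -> admissible (fill_boxes k ks b).
Proof.
have pos : forall ks k b, (1 <= k)%N -> all (leq 1) ks ->
    all (leq 1) (fill_boxes k ks b).
  elim=> [|l ls IH] h c h1; first by rewrite /= h1.
  case/andP=> l1 ls1; case: c => [|[] c] /=; rewrite ?h1 //.
    by apply: IH => //; lia.
  by apply: IH.
case/and3P=> /= k2 k1 ks1; rewrite /admissible pos // andbT.
elim: ks k b k2 {k1 ks1} => //= l ls IH k [|[] b] k2 //=.
by apply: IH; lia.
Qed.

Lemma interpolate_trunc_cvg (R : realType) k : admissible k ->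
  coef_cvg (fun M => interpolate (zeta_trunc R M) k) (zetat R k).
Proof.
case: k => // k ks kadm; apply: coef_cvg_sum => b _ /=.
apply: coef_cvgM; first exact: coef_cvg_cst.
move=> i; rewrite coefC; under eq_fun do rewrite coefC.
case: eqP => _; last exact: cvg_cst.
by apply: zeta_trunc_cvg; exact: fill_boxes_admissible.
Qed.

(** [ones_prod] evaluates [F] only at compositions of n + v, which is what disposes of the Kronecker
    deltas later. *)
Lemma eq_ones_prod (S : comNzRingType) (t : S) n v F G :
  {in compositions (n + v), F =1 G} -> ones_prod t n v F = ones_prod t n v G.
Proof.
by move=> FG; rewrite !ones_prod_compositions; apply: eq_big_seq => a /FG ->.
Qed.

Lemma ones_prod_cvg (R : realType) n v (F : nat -> seq nat -> {poly R}) G :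
  (forall a, all (leq 1) a -> coef_cvg (F ^~ a) (G a)) ->
  coef_cvg (fun M => ones_prod 'X n v (F M)) (ones_prod 'X n v G).
Proof.
move=> FG; rewrite ones_prod_compositions; under eq_fun do rewrite ones_prod_compositions.
apply: coef_cvg_sum => a; rewrite mem_compositions => /andP[a1 _].
by apply: coef_cvgM; [exact: coef_cvg_cst|exact: FG].
Qed.

Lemma onhead_cvg (R : realType) c (F : nat -> seq nat -> {poly R}) G a :
  (forall x, (c <= x)%N -> coef_cvg (fun M => F M (x :: behead a)) (G (x :: behead a))) ->
  coef_cvg (fun M => onhead c (F M) a) (onhead c G a).
Proof.
by case: a => [|x a] FG; [exact: coef_cvg_cst|apply: FG; exact: leq_addr].
Qed.

Lemma one_run_prod_cvg (R : realType) m u n v (F : nat -> seq nat -> {poly R}) G :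
  (2 <= m)%N -> (2 <= u)%N ->
  (forall k, admissible k -> coef_cvg (F ^~ k) (G k)) ->
  coef_cvg (fun M => one_run_prod 'X u n v (fun w => F M (m :: w)))
    (one_run_prod 'X u n v (fun w => G (m :: w))).
Proof.
move=> m2 u2 FG.
have adm l x w : (2 <= x)%N -> all (leq 1) w ->
    coef_cvg (fun M => F M (m :: nseq l 1%N ++ x :: w)) (G (m :: nseq l 1%N ++ x :: w)).
  move=> x2 w1; apply: FG; rewrite /admissible /= m2 all_cat all_nseq orbT /= w1.
  by rewrite (ltnW m2) (ltnW x2).
apply: coef_cvgD.
  by apply: ones_prod_cvg => a; exact: (adm 0%N).
apply: coef_cvg_sum => l _; apply: ones_prod_cvg => a a1.
apply: coef_cvgD; [apply: coef_cvgD|].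
- exact: adm.
- by apply: coef_cvgM; [exact: coef_cvg_cst|apply: adm => //; lia].
- apply: coef_cvgM; first exact: coef_cvg_cst.
  apply: (@onhead_cvg _ _ (fun M w' => F M (m :: nseq (l - 1) 1%N ++ w'))
    (fun w' => G (m :: nseq (l - 1) 1%N ++ w'))) => x ux.
  by apply: adm; [lia|case: (a) a1 => //= ? ? /andP[]].
Qed.

(** The limit of [two_runs_prodP]: all words that occur have positive entries and head at least 2,
    hence are admissible. *)
Lemma zetat_two_runs (R : realType) m u n v : (2 <= m)%N -> (2 <= u)%N ->
  zetat R (m :: nseq n 1%N) * zetat R (u :: nseq v 1%N) =
    one_run_prod 'X u n v (fun w => zetat R (m :: w))
    + one_run_prod 'X m v n (fun w => zetat R (u :: w))
    + (1 - 2%:R * 'X) * ones_prod 'X n v (fun w => zetat R ((m + u)%N :: w))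
    + ('X ^+ 2 - 'X) * ones_prod 'X n v (onhead (m + u) (zetat R)).
Proof.
move=> m2 u2; pose A M := interpolate (zeta_trunc R M).
have cvgA k : admissible k -> coef_cvg (A ^~ k) (zetat R k).
  exact: interpolate_trunc_cvg.
have adm k l : (2 <= k)%N -> admissible (k :: nseq l 1%N).
  by move=> k2; rewrite /admissible /= k2 all_nseq orbT ltnW.
apply: (@coef_cvg_unique _ (fun M => A M (m :: nseq n 1%N) * A M (u :: nseq v 1%N))).
  by apply: coef_cvgM; apply: cvgA; exact: adm.
under eq_fun do rewrite (two_runs_prodP (interpolate_truncP R)).
apply: coef_cvgD; [apply: coef_cvgD; [apply: coef_cvgD|]|].
- exact: (@one_run_prod_cvg _ m u n v A (zetat R)).
- exact: (@one_run_prod_cvg _ u m v n A (zetat R)).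
- apply: coef_cvgM; first exact: coef_cvg_cst.
  apply: ones_prod_cvg => a a1; apply: cvgA.
  by rewrite /admissible /= a1; lia.
- apply: coef_cvgM; first exact: coef_cvg_cst.
  apply: ones_prod_cvg => a a1; apply: onhead_cvg => x mux; apply: cvgA.
  by rewrite /admissible /=; case: a a1 => [|y a] /= => [_|/andP[_ ->]]; lia.
Qed.

(** [sum_tuplesA_ones_prod] for v and n - l. The delta factor differs from 1 only for v = 0 and n =
    l; then the only composition is empty and the term is 0. *)
Lemma sum_tuplesA_run (S : comNzRingType) (t : S) (F : seq nat -> S) m u n v l :
    (l <= n)%N ->
  \sum_(0 <= k < (minn v (n - l)).+1)
    \sum_(0 <= i < k.+1) \sum_(0 <= j < k.+1 | (i + j == k)%N)
    \sum_(a <- tuplesA (v + n - l - i - k) (n + v - l) j)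
      'C(v + n - l - 2 * k, v - k)%:R
      * (t ^+ 2 - t) ^+ i * (1 - 2%:R * t) ^+ j
      * (F (m :: nseq l 1%N ++ u :: a)
         + (1 - 2%:R * t) * F (m :: nseq (l - 1) 1%N ++ (u + 1)%N :: a)
         + (if a is a1 :: a' then
              (1 - (v == 0%N)%:R * (n == l)%:R) * (t ^+ 2 - t)
              * F (m :: nseq (l - 1) 1%N ++ (u + 1 + a1)%N :: a')
            else 0))
  = ones_prod t v (n - l) (fun a =>
      F (m :: nseq l 1%N ++ u :: a)
      + (1 - 2%:R * t) * F (m :: nseq (l - 1) 1%N ++ (u + 1)%N :: a)
      + (t ^+ 2 - t) * onhead (u + 1) (fun w => F (m :: nseq (l - 1) 1%N ++ w)) a).
Proof.
move=> ln.
have -> : (v + n - l = n - l + v)%N by lia.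
have -> : (n + v - l = v + (n - l))%N by lia.
rewrite (sum_tuplesA_ones_prod t v (n - l) (fun a => F (m :: nseq l 1%N ++ u :: a)
         + (1 - 2%:R * t) * F (m :: nseq (l - 1) 1%N ++ (u + 1)%N :: a)
         + (if a is a1 :: a' then
              (1 - (v == 0%N)%:R * (n == l)%:R) * (t ^+ 2 - t)
              * F (m :: nseq (l - 1) 1%N ++ (u + 1 + a1)%N :: a')
            else 0))).
apply: eq_ones_prod => -[|x a]; first by rewrite /= mulr0.
rewrite mem_compositions => /andP[/andP[x1 _] /eqP /= xa]; congr (_ + _); congr (_ * _).
case: (v =P 0%N) => v0; case: (n =P l) => nl; rewrite ?(mulr0, mul0r, subr0, mul1r) //.
by exfalso; move: xa x1; rewrite v0 nl subnn; lia.
Qed.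

Lemma sum_tuplesA_heads (S : comNzRingType) (t : S) (F : seq nat -> S) m u n v :
  \sum_(0 <= k < (minn n v).+1)
    \sum_(0 <= i < k.+1) \sum_(0 <= j < k.+1 | (i + j == k)%N)
    \sum_(a <- tuplesA (v + n - i - k) (n + v) j)
      'C(v + n - 2 * k, n - k)%:R
      * (t ^+ 2 - t) ^+ i * (1 - 2%:R * t) ^+ j
      * (F [:: m, u & a] + F [:: u, m & a] + (1 - 2%:R * t) * F ((m + u)%N :: a)
         + (if a is a1 :: a' then
              (1 - (n == 0%N)%:R * (v == 0%N)%:R) * (t ^+ 2 - t)
              * F ((m + u + a1)%N :: a')
            else 0))
  = ones_prod t n v (fun a =>
      F [:: m, u & a] + F [:: u, m & a] + (1 - 2%:R * t) * F ((m + u)%N :: a)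
      + (t ^+ 2 - t) * onhead (m + u) F a).
Proof.
rewrite (sum_tuplesA_ones_prod t n v (fun a => F [:: m, u & a] + F [:: u, m & a]
         + (1 - 2%:R * t) * F ((m + u)%N :: a)
         + (if a is a1 :: a' then
              (1 - (n == 0%N)%:R * (v == 0%N)%:R) * (t ^+ 2 - t)
              * F ((m + u + a1)%N :: a')
            else 0))).
apply: eq_ones_prod => -[|x a]; first by rewrite /= mulr0.
rewrite mem_compositions => /andP[/andP[x1 _] /eqP /= xa]; congr (_ + _); congr (_ * _).
case: (n =P 0%N) => n0; case: (v =P 0%N) => v0; rewrite ?(mulr0, mul0r, subr0, mul1r) //.
by exfalso; move: xa x1; rewrite v0 n0; lia.
Qed.

Theorem corollary1 (R : realType) (m u n v : nat)
    (hm : (2 <= m)%N) (hu : (2 <= u)%N) :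
  zetat R (m :: nseq n 1%N) * zetat R (u :: nseq v 1%N) =
  \sum_(1 <= l < n.+1) \sum_(0 <= k < (minn v (n - l)).+1)
    \sum_(0 <= i < k.+1) \sum_(0 <= j < k.+1 | (i + j == k)%N)
    \sum_(a <- tuplesA (v + n - l - i - k) (n + v - l) j)
      'C(v + n - l - 2 * k, v - k)%:R
      * ('X^2 - 'X) ^+ i * (1 - 2%:R * 'X) ^+ j
      * (zetat R (m :: nseq l 1%N ++ u :: a)
         + (1 - 2%:R * 'X) * zetat R (m :: nseq (l - 1) 1%N ++ (u + 1)%N :: a)
         + (if a is a1 :: a' then
              (1 - (v == 0%N)%:R * (n == l)%:R) * ('X^2 - 'X)
              * zetat R (m :: nseq (l - 1) 1%N ++ (u + 1 + a1)%N :: a')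
            else 0))
  + \sum_(1 <= l < v.+1) \sum_(0 <= k < (minn n (v - l)).+1)
    \sum_(0 <= i < k.+1) \sum_(0 <= j < k.+1 | (i + j == k)%N)
    \sum_(a <- tuplesA (v + n - l - i - k) (n + v - l) j)
      'C(v + n - l - 2 * k, n - k)%:R
      * ('X^2 - 'X) ^+ i * (1 - 2%:R * 'X) ^+ j
      * (zetat R (u :: nseq l 1%N ++ m :: a)
         + (1 - 2%:R * 'X) * zetat R (u :: nseq (l - 1) 1%N ++ (m + 1)%N :: a)
         + (if a is a1 :: a' then
              (1 - (n == 0%N)%:R * (v == l)%:R) * ('X^2 - 'X)
              * zetat R (u :: nseq (l - 1) 1%N ++ (m + 1 + a1)%N :: a')
            else 0))
  + \sum_(0 <= k < (minn n v).+1)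
    \sum_(0 <= i < k.+1) \sum_(0 <= j < k.+1 | (i + j == k)%N)
    \sum_(a <- tuplesA (v + n - i - k) (n + v) j)
      'C(v + n - 2 * k, n - k)%:R
      * ('X^2 - 'X) ^+ i * (1 - 2%:R * 'X) ^+ j
      * (zetat R [:: m, u & a] + zetat R [:: u, m & a]
         + (1 - 2%:R * 'X) * zetat R ((m + u)%N :: a)
         + (if a is a1 :: a' then
              (1 - (n == 0%N)%:R * (v == 0%N)%:R) * ('X^2 - 'X)
              * zetat R ((m + u + a1)%N :: a')
            else 0)).
Proof.
have E := ones_prod_lin ('X : {poly R}) n v.
rewrite zetat_two_runs // sum_tuplesA_heads !(lin_functionalD _ _ E) !(lin_functionalZ _ _ E).
(* The summands headed m, u and u, m, with no run of 1s in between, belong to the third sum. *)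
rewrite /one_run_prod [ones_prod _ v n _]ones_prodC.
set S1 := \sum_(1 <= l < n.+1) ones_prod _ _ _ _.
set S2 := \sum_(1 <= l < v.+1) ones_prod _ _ _ _.
rewrite [X in _ = X + _ + _](_ : _ = S1); last first.
  by apply: eq_big_nat => l /andP[_ ln]; exact: (sum_tuplesA_run 'X (zetat R)).
rewrite [X in _ = _ + X + _](_ : _ = S2); last first.
  apply: eq_big_nat => l /andP[_ lv].
  (* The second sum is the first with (m, n) and (u, v) exchanged, up to the order of v + n. *)
  have := sum_tuplesA_run 'X (zetat R) u m n (lv : (l <= v)%N).
  by rewrite !(addnC v n) => ->.
by ring.
Qed.
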